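(* Every nil-reversible ring is nil-Armendariz.
   Context: All rings are associative with identity. For a ring $R$, $N(R)$ denotes the set of all nilpotent elements of $R$, and $N(R)[x]$ denotes the set of polynomials in $R[x]$ all of whose coefficients lie in $N(R)$. For $a\in R$, $l(a)=\{x\in R: xa=0\}$ and $r(a)=\{x\in R: ax=0\}$. A ring $R$ is nil-reversible if $l(a)=r(a)$ for every $a\in N(R)$. A ring $R$ is nil-Armendariz if whenever $f(x)=\sum_{i=0}^{n}w_ix^i$ and $g(x)=\sum_{j=0}^{m}h_jx^j$ in $R[x]$ satisfy $f(x)g(x)\in N(R)[x]$, then $w_ih_j\in N(R)$ for all $i,j$. *)

(* Defs.v *)
From HB Require Import structures.
From mathcomp Require Import all_boot all_algebra.

Set Implicit Arguments.
Unset Strict Implicit.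
Unset Printing Implicit Defensive.

Import GRing.Theory.
Local Open Scope ring_scope.

Definition nilpotent_elt (R : pzRingType) (a : R) : Prop :=
  exists n : nat, a ^+ n = 0.

Definition left_annihilator (R : pzRingType) (a : R) : pred R :=
  [pred x | x * a == 0].

Definition right_annihilator (R : pzRingType) (a : R) : pred R :=
  [pred x | a * x == 0].

Definition nil_reversible (R : pzRingType) : Prop :=
  forall a : R, nilpotent_elt a ->
    left_annihilator a =i right_annihilator a.

(* Coefficients beyond the size of a polynomial are 0, so ranging over all
   indices i, j amounts to ranging over those up to the formal degrees. *)
Definition nil_Armendariz_nz (R : nzRingType) : Prop :=
  forall f g : {poly R},
    (forall k : nat, nilpotent_elt (f * g)`_k) ->
    forall i j : nat, nilpotent_elt (f`_i * g`_j).

Definition nzRing_of (R : pzRingType) (nz1 : (1 : R) != 0) : nzRingType :=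
  HB.pack_for nzRingType R (GRing.PzSemiRing_isNonZero.Build R nz1).

(* {poly R} is only available for rings in which 1 != 0. In the zero ring every
   element is nilpotent, so there the property holds vacuously. *)
Definition nil_Armendariz (R : pzRingType) : Prop :=
  forall nz1 : (1 : R) != 0, nil_Armendariz_nz (nzRing_of nz1).

Lemma nil_ArmendarizE (R : nzRingType) :
  nil_Armendariz R <-> nil_Armendariz_nz R.
Proof.
have E (nz1 : (1 : R) != 0) : nzRing_of nz1 = R.
  case: R nz1 => T [a b c d e f g h i j [nz]] nz1.
  by rewrite (bool_irrelevance nz1 nz).
split=> [H | H nz1]; first by have := H (oner_neq0 R); rewrite E.
by rewrite E.
Qed.

(* Main.v *)
Require Import Defs.
From mathcomp Require Import all_boot all_algebra.

(** Nil-reversibility gives a restricted insertion property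
    ([nil_reversible_insert]): if [y * c = 0] with [c] nilpotent, then
    [y * r * c = 0] for all [r].  Since the powers of a nilpotent element are
    nilpotent, factors can be inserted inside any vanishing product of the form
    [y * a ^+ n], so that every nilpotent element generates a nilpotent ideal.
    Consequently the nilpotent elements form a two-sided ideal [N]
    ([nilpotent_add], [nilpotent_mull], [nilpotent_mulr]), and [R / N] is
    reduced, because an element with a power in [N] lies in [N].

    Reduced rings are Armendariz by a classical argument, which is carried out
    here modulo [N] without forming the quotient ([nil_convolution]).  Suppose
    that [c_k = \sum_(i' + j' = k) w_i' * h_j'] is in [N], and multiply it on
    the right by [w_i].  With [j = k - i], the terms with [i' < i] are in [N] by
    induction on [i]; those with [i' > i] have [i + j' < k], so that [w_i * h_j']
    and hence [h_j' * w_i] are in [N] by induction on [k].  The only term left is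
    [w_i * h_j * w_i], which is therefore in [N]; so is the square of
    [w_i * h_j], and [w_i * h_j] itself. *)

Set Implicit Arguments.
Unset Strict Implicit.
Unset Printing Implicit Defensive.

Import GRing.Theory.
Local Open Scope ring_scope.

Lemma nilpotent_of_exp (R : pzRingType) (a : R) (n : nat) :
  nilpotent_elt (a ^+ n) -> nilpotent_elt a.
Proof. by case=> m am0; exists (n * m)%N; rewrite exprM. Qed.

Lemma nilpotent_exp (R : pzRingType) (a : R) (n : nat) :
  nilpotent_elt a -> nilpotent_elt (a ^+ n.+1).
Proof.
by case=> m am0; exists m; rewrite -exprM mulnC exprM am0 expr0n.
Qed.

(** A power of [b * a] regroups as [(b * a) ^+ n.+1 = b * (a * b) ^+ n * a]. *)
Lemma nilpotent_mulC (R : pzRingType) (a b : R) :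
  nilpotent_elt (a * b) -> nilpotent_elt (b * a).
Proof.
case=> n abn0; exists n.+1.
suff -> : (b * a) ^+ n.+1 = b * (a * b) ^+ n * a by rewrite abn0 mulr0 mul0r.
elim: n {abn0} => [|n IHn]; first by rewrite expr1 expr0 mulr1.
by rewrite exprSr IHn [(a * b) ^+ n.+1]exprSr !mulrA.
Qed.

(** Reversing the product, multiplying by [r] on the free side and reversing
    again moves [r] between the two factors. *)
Lemma nil_reversible_insert (R : pzRingType) (c y r : R) :
  nil_reversible R -> nilpotent_elt c -> y * c = 0 -> y * r * c = 0.
Proof.
move=> revR /revR rev_c yc0; apply/eqP.
have := rev_c y; rewrite !inE yc0 eqxx => /esym/eqP cy0.
by have := rev_c (y * r); rewrite !inE mulrA cy0 mul0r eqxx.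
Qed.

Section NilRadical.

Variables (R : pzRingType).
Hypothesis revR : nil_reversible R.

(** Insertion puts [r] in front of each of the factors [a] in turn.
    The statement is generalized from [1] to a left factor [y], because the
    induction moves one factor [r * a] at a time into [y]. *)
Lemma mul_exp_mull_eq0 (a r y : R) (n : nat) :
  nilpotent_elt a -> y * a ^+ n = 0 -> y * (r * a) ^+ n = 0.
Proof.
move=> nil_a; elim: n y => [|n IHn] y; first by [].
move=> yan0; rewrite exprS mulrA; apply: IHn.
have := nil_reversible_insert r revR (nilpotent_exp n nil_a) yan0.
by rewrite exprS !mulrA.
Qed.

Lemma nilpotent_mull (r a : R) : nilpotent_elt a -> nilpotent_elt (r * a).
Proof.
move=> nil_a; have [n an0] := nil_a; exists n.
by rewrite -[LHS]mul1r mul_exp_mull_eq0 // mul1r.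
Qed.

Lemma nilpotent_mulr (r a : R) : nilpotent_elt a -> nilpotent_elt (a * r).
Proof. by move=> nil_a; apply: nilpotent_mulC; apply: nilpotent_mull. Qed.

(** Expanding [(a + b) ^+ (m + n)] gives words with at least [m] letters [a] or
    at least [n] letters [b], and these vanish by insertion.  The left factor
    [y] stands for the part of the word already read, and [m] and [n] for the
    numbers of letters that it still takes to reach [0]. *)
Lemma mul_exp_add_eq0 (a b y : R) (m n : nat) :
  nilpotent_elt a -> nilpotent_elt b ->
  y * a ^+ m = 0 -> y * b ^+ n = 0 -> y * (a + b) ^+ (m + n) = 0.
Proof.
move=> nil_a nil_b.
move def_s: (m + n)%N => s; elim: s m n def_s y => [|s IHs] m n.
  by move=> /eqP; rewrite addn_eq0 => /andP[/eqP-> _] y; rewrite !expr0.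
case: m => [|m] def_s y yam0 ybn0.
  by rewrite expr0 mulr1 in yam0; rewrite yam0 mul0r.
case: n def_s ybn0 => [|n] def_s ybn0.
  by rewrite expr0 mulr1 in ybn0; rewrite ybn0 mul0r.
have yabn0 := nil_reversible_insert a revR (nilpotent_exp n nil_b) ybn0.
have ybam0 := nil_reversible_insert b revR (nilpotent_exp m nil_a) yam0.
have def_s1 : (m + n.+1)%N = s by case: def_s.
have def_s2 : (m.+1 + n)%N = s by rewrite addSnnS.
rewrite exprS mulrA in yam0; rewrite exprS mulrA in ybn0.
rewrite exprS mulrA mulrDr mulrDl.
by rewrite (IHs _ _ def_s1) // (IHs _ _ def_s2) // addr0.
Qed.

Lemma nilpotent_add (a b : R) :
  nilpotent_elt a -> nilpotent_elt b -> nilpotent_elt (a + b).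
Proof.
move=> nil_a nil_b; have [m am0] := nil_a; have [n bn0] := nil_b.
by exists (m + n)%N; rewrite -[LHS]mul1r mul_exp_add_eq0 ?mul1r.
Qed.

Lemma nilpotent_sub (a b : R) :
  nilpotent_elt a -> nilpotent_elt b -> nilpotent_elt (a - b).
Proof.
by move=> nil_a nil_b; rewrite -mulN1r; apply/nilpotent_add/nilpotent_mull.
Qed.

Lemma nilpotent_sum (I : Type) (s : seq I) (P : pred I) (F : I -> R) :
  (forall i, P i -> nilpotent_elt (F i)) ->
  nilpotent_elt (\sum_(i <- s | P i) F i).
Proof.
move=> nilF; apply: big_ind => //; first by exists 1%N; rewrite expr1.
exact: nilpotent_add.
Qed.

(** This is the proof that the reduced ring [R / N] is Armendariz, by induction
    on [k = i + j] and then on [i].  Coefficient sequences replace polynomials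
    so that it makes sense also in the zero ring. *)
Lemma nil_convolution (w h : nat -> R) :
  (forall k, nilpotent_elt (\sum_(i < k.+1) w i * h (k - i)%N)) ->
  forall i j, nilpotent_elt (w i * h j).
Proof.
move=> nil_c i j; move: {2}(i + j)%N (erefl (i + j)%N) => k.
elim/ltn_ind: k i j => k IHk i; elim/ltn_ind: i => i IHi j def_k.
(* It suffices that [w i * h j * w i] is nilpotent. *)
apply: (@nilpotent_of_exp _ _ 2); rewrite expr2 mulrA; apply: nilpotent_mulr.
have lt_ik : (i < k.+1)%N by rewrite ltnS -def_k leq_addr.
have := nil_c k; rewrite (bigD1 (Ordinal lt_ik)) //= -{1}def_k addKn.
move=> /(nilpotent_mulr (w i)); rewrite mulrDl mulr_suml.
set rest := \sum_(_ < _ | _) _ => nil_ck.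
(* [nil_ck] is about [w i * h j * w i + rest], so only [rest] remains. *)
rewrite -[_ * w i](addrK rest); apply: nilpotent_sub => //.
apply: nilpotent_sum => i' ne_i'i.
have le_i'k : (i' <= k)%N by rewrite -ltnS.
case: (ltngtP i' i) => [lt_i'i | lt_ii' | eq_i'i].
- by apply: nilpotent_mulr; apply: IHi; rewrite ?subnKC.
  (* Here [w i * h (k - i')] has index sum below [k]; reversing it makes the
     tail of [w i' * (h (k - i') * w i)] nilpotent. *)
- rewrite -mulrA; apply/nilpotent_mull/nilpotent_mulC.
  apply: IHk (erefl _).
  by rewrite -[ltnRHS](subnKC le_i'k) ltn_add2r.
- by case/eqP: ne_i'i; apply: val_inj.
Qed.

End NilRadical.

Theorem proposition3p10 (R : pzRingType) :
  nil_reversible R -> nil_Armendariz R.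
Proof.
move=> revR nz1 f g nil_fg.
apply: (@nil_convolution (nzRing_of nz1)) => // k.
by rewrite -coefM.
Qed.
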